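(* Let $d\in\mathbb{N}$ and $\alpha\in(0,2)$ with $\alpha<d<2\alpha$. Suppose that $V\in\mathcal{R}_{d,\alpha}$ is non-negative, radially symmetric, with non-increasing profile $v$. Then there exists $t_0>0$ such that $$v(t)<\frac{2^{d-\alpha}\|V\|_{\mathcal{R}_{d,\alpha}}}{\omega_d}\,t^{-\alpha},\qquad t\in(0,t_0).$$
   Context: The fractional Rollnik-class $\mathcal{R}_{d,\alpha}$ (for $0<\alpha<2$, $\alpha<d<2\alpha$) is the set of functions $V:\mathbb{R}^d\to\mathbb{R}$ with $$\|V\|^2_{\mathcal{R}_{d,\alpha}}=\int_{\mathbb{R}^d}\int_{\mathbb{R}^d}\frac{|V(x)||V(y)|}{|x-y|^{2(d-\alpha)}}\,dx\,dy<\infty .$$ The profile of a non-negative radially symmetric $V$ is the function $v:[0,\infty)\to[0,\infty]$ such that $v(t)=V(x)$ for all $x\in\mathbb{R}^d$ with $|x|=t$. $\omega_d$ is the Lebesgue measure of the unit ball of $\mathbb{R}^d$.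
   Formalization: V is additionally assumed not to vanish almost everywhere: for V = 0 a.e. both v(t), t > 0, and the Rollnik norm are 0, so the strict inequality would read 0 < 0. V is also allowed to take the value +∞. *)

(* Defs.v *)
From HB Require Import structures.
From mathcomp Require Import all_boot all_order all_algebra.
From mathcomp Require Import all_classical all_reals all_analysis.
From mathcomp Require Import measurable_realfun.

Set Implicit Arguments.
Unset Strict Implicit.
Unset Printing Implicit Defensive.

Import Order.TTheory GRing.Theory Num.Theory.
Import numFieldNormedType.Exports.

Local Open Scope classical_set_scope.
Local Open Scope ring_scope.

(* [measurableTypeR R] is R with its Borel sets, and tuples carry the product
   sigma-algebra, so the measurable subsets of [Rn R n] are the Borel sets of
   R^n. *)
Notation Rn R n := (n.-tuple (measurableTypeR R)).

Section lebesgue_measure_Rn.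
Context {R : realType}.

Definition cons_Rn n (p : measurableTypeR R * Rn R n) : Rn R n.+1 :=
  [tuple of p.1 :: p.2].

Lemma measurable_cons_Rn n : measurable_fun [set: _] (@cons_Rn n).
Proof. exact: measurable_cons. Qed.

Definition lebesgue_cons n (mu : {sigma_finite_measure set (Rn R n) -> \bar R})
    : set (Rn R n.+1) -> \bar R :=
  pushforward (@lebesgue_measure R \x mu)%E (@cons_Rn n).

Section instances.
Variables (n : nat) (mu : {sigma_finite_measure set (Rn R n) -> \bar R}).

Let lebesgue_cons0 : lebesgue_cons mu set0 = 0%E.
Proof. by rewrite /lebesgue_cons /pushforward preimage_set0 measure0. Qed.

Let lebesgue_cons_ge0 A : (0 <= lebesgue_cons mu A)%E.
Proof. by rewrite /lebesgue_cons /pushforward; exact: measure_ge0. Qed.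

Let lebesgue_cons_sigma_additive : semi_sigma_additive (lebesgue_cons mu).
Proof.
move=> F mF tF mUF; rewrite /lebesgue_cons /pushforward preimage_bigcup.
have mpre B : measurable B -> measurable (@cons_Rn n @^-1` B).
  by move=> mB; rewrite -[X in measurable X]setTI; exact: measurable_cons_Rn.
apply: measure_semi_sigma_additive.
- by move=> k; exact: mpre.
- apply/trivIsetP => /= i j _ _ ij; rewrite -preimage_setI.
  by move/trivIsetP : tF => /(_ _ _ _ _ ij) ->//; rewrite preimage_set0.
- by rewrite -preimage_bigcup; exact: mpre.
Qed.

HB.instance Definition _ := isMeasure.Build _ _ _ (lebesgue_cons mu)
  lebesgue_cons0 lebesgue_cons_ge0 lebesgue_cons_sigma_additive.

Let lebesgue_cons_sigma_finite : sigma_finite setT (lebesgue_cons mu).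
Proof.
have /sigma_finiteP[F [TF ndF Foo]] := sigma_finiteT (@lebesgue_measure R).
have /sigma_finiteP[G [TG ndG Goo]] := sigma_finiteT mu.
pose u (x : Rn R n.+1) : measurableTypeR R * Rn R n :=
  (tnth x ord0, [tuple of behead x]).
have mu_u : measurable_fun [set: Rn R n.+1] u.
  by apply/measurable_fun_pairP; split;
    [exact: measurable_tnth|exact: measurable_behead].
exists (fun k => u @^-1` (F k `*` G k)).
  apply/esym; rewrite -subTset => x _.
  have [i _ Fi] : (\bigcup_k F k) (u x).1 by rewrite -TF.
  have [j _ Gj] : (\bigcup_k G k) (u x).2 by rewrite -TG.
  exists (maxn i j) => //; split.
  - by move: Fi; exact/subsetPset/ndF/leq_maxl.
  - by move: Gj; exact/subsetPset/ndG/leq_maxr.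
move=> k; have [mF Fk] := Foo k; have [mG Gk] := Goo k; split.
  by rewrite -[X in measurable X]setTI; apply: mu_u => //; exact: measurableX.
rewrite /lebesgue_cons /pushforward -comp_preimage (_ : u \o _ = id).
  by rewrite preimage_id product_measure1E// lte_mul_pinfty// ge0_fin_numE.
by apply/funext => -[a t]; rewrite /u/=; congr pair; apply/val_inj.
Qed.

HB.instance Definition _ := Measure_isSigmaFinite.Build _ _ _
  (lebesgue_cons mu) lebesgue_cons_sigma_finite.

End instances.

(* The n-fold product of the one-dimensional Lebesgue measure. *)
Fixpoint lebesgue_measure_Rn n : {sigma_finite_measure set (Rn R n) -> \bar R} :=
  match n with
  | 0 => \d_([tuple] : Rn R 0)
  | m.+1 => lebesgue_cons (lebesgue_measure_Rn m)
  end.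

End lebesgue_measure_Rn.
Arguments lebesgue_measure_Rn : clear implicits.

Section rollnik.
Context {R : realType} {d : nat}.
Implicit Types (x y : Rn R d) (V : Rn R d -> \bar R) (alpha : R).

Definition enorm x : R := Num.sqrt (\sum_(i < d) (tnth x i : R) ^+ 2).

Definition sub_Rn x y : Rn R d := [tuple (tnth x i : R) - tnth y i | i < d].

Definition unit_ball_volume : R :=
  fine (lebesgue_measure_Rn R d [set x | enorm x < 1]).

(* Potentials are extended-real valued: a profile that is non-increasing on
   [0, +oo[ and finite at 0 is bounded, so singular potentials such as
   |x|^-s need the value +oo at the origin.
   In \bar R, 0^-1 = +oo, so the kernel is +oo on the diagonal x = y. *)
Definition rollnik_sqnorm alpha V : \bar R :=
  (\int[lebesgue_measure_Rn R d]_x \int[lebesgue_measure_Rn R d]_y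
    (`|V x| * `|V y| / (enorm (sub_Rn x y) `^ (2 * (d%:R - alpha)))%R%:E))%E.

Definition rollnik_norm alpha V : R := Num.sqrt (fine (rollnik_sqnorm alpha V)).

Definition rollnik_class alpha V : Prop :=
  measurable_fun [set: Rn R d] V /\ (rollnik_sqnorm alpha V < +oo)%E.

Definition radially_symmetric V : Prop :=
  forall x y, enorm x = enorm y -> V x = V y.

(* A profile lives on [0, +oo[; its values at negative reals are irrelevant. *)
Definition is_profile V (v : R -> \bar R) : Prop :=
  forall t, 0 <= t -> forall x, enorm x = t -> v t = V x.

End rollnik.
Arguments unit_ball_volume : clear implicits.

(* Main.v *)
(* On the ball B_t of radius t one has V >= v(t), and any two of its points are
   at distance at most 2t, so that
     ||V||^2 >= v(t)^2 (2t)^(-2(d-alpha)) |B_t|^2,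
   which is the asserted bound with <= in place of <.  The inequality is strict
   at every t: on B_(t/2) x B_(t/2) the kernel is even at least t^(-2(d-alpha)),
   which adds a positive term to the right-hand side. *)
Require Import Defs.
From mathcomp Require Import all_boot all_order all_algebra.
From mathcomp Require Import all_classical all_reals all_analysis.
From mathcomp Require Import measurable_realfun.
From mathcomp Require Import ring lra.

Import Order.TTheory GRing.Theory Num.Theory.
Import numFieldNormedType.Exports.

Local Open Scope classical_set_scope.
Local Open Scope ring_scope.

(* Unlike in [ge0_le_integral], f and g need not be measurable, because the
   integral of a nonnegative function is a supremum over the simple functions
   below it. *)
Lemma ge0_integral_le d (T : measurableType d) (R : realType)
    (mu : {measure set T -> \bar R}) (f g : T -> \bar R) :
  (forall x, 0 <= f x)%E -> (forall x, f x <= g x)%E ->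
  (\int[mu]_x f x <= \int[mu]_x g x)%E.
Proof.
move=> f0 fg; have g0 x : (0 <= g x)%E by exact: le_trans (f0 x) (fg x).
rewrite !ge0_integralTE//; apply: ge_ereal_sup => _ [h hf <-].
by apply: ereal_sup_ubound; exists h => // x; exact: le_trans (hf x) (fg x).
Qed.

(** * Lebesgue measure on R and R^n under dilations *)

(** Bundles a rescaled image measure as a measure, so that it can be the competitor in the
    uniqueness theorems for Lebesgue and product measures. *)
Lemma mscale_pushforward_measure d d' (T : measurableType d)
    (T' : measurableType d') (R : realType) (mu : {measure set T -> \bar R})
    (f : T -> T') (k : R) :
  measurable_fun [set: T] f -> 0 <= k ->
  exists m : {measure set T' -> \bar R},
    forall A, m A = (k%:E * mu (f @^-1` A))%E.
Proof.
by move=> mf k0; unshelve eexists (mscale (NngNum k0) (pushforward mu f)).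
Qed.

(** The right-hand side is a measure in [A] that gives each interval ]a, b] its length, so
    uniqueness of Lebesgue measure applies. *)
Lemma lebesgue_measure_preimage_mulr (R : realType) (c : R) (A : set R) :
  0 < c -> measurable A ->
  lebesgue_measure A = (c%:E * lebesgue_measure ( *%R c @^-1` A))%E.
Proof.
move=> c0 mA.
have [m mE] := @mscale_pushforward_measure _ _ _ _ _ (@lebesgue_measure R)
  ( *%R c : R -> measurableTypeR R) c (@mulrl_measurable _ _ c) (ltW c0).
rewrite -mE; apply: lebesgue_measure_unique => // _ [[a b] /= _ <-].
rewrite mE; have -> : *%R c @^-1` [set` `]a, b]] = [set` `]a / c, b / c]].
  apply/seteqP; split => x /=; rewrite !in_itv/= ltr_pdivrMr// ler_pdivlMr//;
    by rewrite !(mulrC x).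
rewrite lebesgue_measure_itv /= [in RHS]lebesgue_measure_itv/= !lte_fin.
rewrite ltr_pM2r ?invr_gt0//.
case: ifP => _; last by rewrite mule0.
by rewrite -!EFinD -EFinM -mulrBl mulrC divfK// gt_eqF.
Qed.

Definition scale_Rn {R : realType} {n} (c : R) (x : Rn R n) : Rn R n :=
  [tuple of map ( *%R c) x].

Lemma measurable_scale_Rn (R : realType) n (c : R) :
  measurable_fun [set: Rn R n] (scale_Rn c).
Proof.
apply/measurable_fun_tnthP => i.
rewrite (_ : _ \o _ = ( *%R c : R -> measurableTypeR R) \o (@tnth _ _ ^~ i)).
  apply: measurableT_comp; first exact: mulrl_measurable.
  exact: measurable_tnth.
by apply/funext => x /=; rewrite tnth_map.
Qed.

Lemma lebesgue_measure_RnS (R : realType) n (A : set (Rn R n.+1)) :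
  lebesgue_measure_Rn R n.+1 A =
  (@lebesgue_measure R \x lebesgue_measure_Rn R n)%E (@cons_Rn R n @^-1` A).
Proof. by []. Qed.

(** Induction on [n]: carried to the product along [cons_Rn], the right-hand side is a measure that
    agrees with the product measure on rectangles, by the one-dimensional case and the induction
    hypothesis. *)
Lemma lebesgue_measure_Rn_preimage_scale (R : realType) n (c : R)
    (A : set (Rn R n)) : 0 < c -> measurable A ->
  lebesgue_measure_Rn R n A =
  ((c ^+ n)%:E * lebesgue_measure_Rn R n (scale_Rn c @^-1` A))%E.
Proof.
move=> c0; elim: n => [|n IH] in A *.
  move=> mA; rewrite expr0 mul1e; congr (lebesgue_measure_Rn R 0 _).
  by apply/seteqP; split => x /=; rewrite (tuple0 x) (tuple0 (scale_Rn _ _)).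
move=> mA; rewrite !lebesgue_measure_RnS.
have mpre B : measurable B -> measurable (@cons_Rn R n @^-1` B).
  by move=> mB; rewrite -[X in measurable X]setTI; exact: measurable_cons_Rn.
(* [S] is the dilation [scale_Rn c] read through [cons_Rn]. *)
pose S (p : measurableTypeR R * Rn R n) : measurableTypeR R * Rn R n :=
  (c * p.1, scale_Rn c p.2).
have mS : measurable_fun setT S.
  apply/measurable_fun_pairP; split.
    exact: (measurableT_comp (@mulrl_measurable _ _ c) measurable_fst).
  exact: (measurableT_comp (@measurable_scale_Rn _ _ c) measurable_snd).
have [m mE] := @mscale_pushforward_measure _ _ _ _ _
  (@lebesgue_measure R \x lebesgue_measure_Rn R n)%E S (c ^+ n.+1) mS
  (exprn_ge0 _ (ltW c0)).
rewrite /= in mE.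
rewrite (product_measure_unique (m' := m)); last 2 first.
- move=> B C mB mC; rewrite mE (_ : S @^-1` _ =
    ( *%R c @^-1` B) `*` (scale_Rn c @^-1` C))//.
  rewrite product_measure1E; last 2 first.
    by rewrite -[X in measurable X]setTI; exact: mulrl_measurable.
    by rewrite -[X in measurable X]setTI; exact: measurable_scale_Rn.
  rewrite /= (lebesgue_measure_preimage_mulr _ _ _ c0 mB) (IH _ mC).
  by rewrite exprS EFinM muleACA.
- exact: mpre.
rewrite mE; congr (_ * (_ \x _) _)%E.
apply/seteqP; split => -[x y] /=; rewrite /cons_Rn/=;
  by congr (A _); apply/val_inj.
Qed.

(** * Volume of cubes *)

Lemma measurable_Rn_box (R : realType) n (e : R) :
  measurable [set x : Rn R n | forall i, `|tnth x i| <= e].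
Proof.
rewrite (_ : mkset _ = \bigcap_(i in [set: 'I_n])
    ((@tnth _ _ ^~ i) @^-1` `[- e, e]%classic)); last first.
  apply/seteqP; split => x /= xe i => [_|]; first by rewrite /= in_itv/= -ler_norml.
  by have := xe i I; rewrite /= in_itv/= -ler_norml.
apply: fin_bigcap_measurable => // i _.
rewrite -[X in measurable X]setTI.
by apply: measurable_tnth => //; exact: measurable_itv.
Qed.

Lemma lebesgue_measure_Rn_box (R : realType) n (e : R) : 0 <= e ->
  lebesgue_measure_Rn R n [set x | forall i, `|tnth x i| <= e] =
  ((2 * e) ^+ n)%:E.
Proof.
move=> e0; elim: n => [|n IH].
  rewrite (_ : mkset _ = setT); last by apply/seteqP; split => // x _ [].
  by rewrite expr0 /= diracT.
rewrite lebesgue_measure_RnS (_ : _ @^-1` _ =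
    `[- e, e]%classic `*` [set x | forall i, `|tnth x i| <= e]); last first.
  apply/seteqP; split => -[x y]/=.
    move=> xy; split=> [|i].
      by have := xy ord0; rewrite tnth0 ler_norml in_itv.
    by have := xy (lift ord0 i); rewrite tnthS.
  case; rewrite in_itv/= -ler_norml => xe ye i.
  by case: (unliftP ord0 i) => [j|] ->; rewrite ?tnth0// tnthS.
rewrite product_measure1E; [|exact: measurable_itv|exact: measurable_Rn_box].
rewrite /= IH exprS EFinM; congr (_ * _)%E.
rewrite lebesgue_measure_itv/= lte_fin.
case: ifPn => [_|]; first by rewrite -EFinD opprK mulr2n mulrDl mul1r.
(* Here [e <= - e], so [e = 0] and both sides vanish. *)
by rewrite -leNgt => ?; congr EFin; lra.
Qed.

(** * Euclidean norm and volume of balls *)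

Lemma measurable_enorm (R : realType) d :
  measurable_fun [set: Rn R d] (@enorm R d).
Proof.
have ms : measurable_fun [set: R] (@Num.sqrt R).
  by apply: continuous_measurable_fun; exact: sqrt_continuous.
apply: (measurableT_comp ms).
apply: measurable_sum => i; apply: measurable_funX; exact: measurable_tnth.
Qed.

Lemma enorm_ge0 (R : realType) d (x : Rn R d) : 0 <= enorm x.
Proof. exact: sqrtr_ge0. Qed.

Lemma sqr_enorm (R : realType) d (x : Rn R d) :
  enorm x ^+ 2 = \sum_(i < d) (tnth x i : R) ^+ 2.
Proof. by rewrite sqr_sqrtr// sumr_ge0// => i _; exact: sqr_ge0. Qed.

Lemma enorm_scale_Rn (R : realType) d (c : R) (x : Rn R d) :
  0 <= c -> enorm (scale_Rn c x) = c * enorm x.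
Proof.
move=> c0; rewrite /enorm -[in RHS](ger0_norm c0) -sqrtr_sqr -sqrtrM ?sqr_ge0//.
by rewrite mulr_sumr; congr Num.sqrt; apply: eq_bigr => i _; rewrite tnth_map exprMn.
Qed.

Lemma ler_abs_enorm (R : realType) d (x : Rn R d) i : `|tnth x i : R| <= enorm x.
Proof.
rewrite -ler_sqr ?nnegrE ?normr_ge0 ?enorm_ge0// sqr_enorm real_normK ?num_real//.
by rewrite (bigD1 i)//= lerDl sumr_ge0// => j _; exact: sqr_ge0.
Qed.

(** In each coordinate (a - b)^2 = 2 a^2 + 2 b^2 - (a + b)^2; dropping the last square and summing
    gives |x - y|^2 <= 4 t^2 without the triangle inequality. *)
Lemma enorm_sub_Rn_le (R : realType) d (x y : Rn R d) (t : R) :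
  enorm x <= t -> enorm y <= t -> enorm (sub_Rn x y) <= 2 * t.
Proof.
move=> xt yt; have t0 : 0 <= t by exact: le_trans (enorm_ge0 _ _ x) xt.
rewrite -ler_sqr ?nnegrE ?mulr_ge0 ?enorm_ge0//.
apply: (@le_trans _ _ (2 * enorm x ^+ 2 + 2 * enorm y ^+ 2)).
  rewrite !sqr_enorm !mulr_sumr -big_split/=; apply: ler_sum => i _.
  rewrite tnth_mktuple; move: (tnth x i : R) (tnth y i : R) => a b.
  by have := sqr_ge0 (a + b); nra.
have x2 : enorm x ^+ 2 <= t ^+ 2 by rewrite ler_sqr ?nnegrE ?enorm_ge0.
have y2 : enorm y ^+ 2 <= t ^+ 2 by rewrite ler_sqr ?nnegrE ?enorm_ge0.
by rewrite exprMn; nra.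
Qed.

Lemma measurable_enorm_ball (R : realType) d (r : R) :
  measurable [set x : Rn R d | enorm x < r].
Proof.
rewrite (_ : mkset _ = @enorm R d @^-1` [set` `]-oo, r[]); last first.
  by apply/seteqP; split => x /=; rewrite in_itv.
rewrite -[X in measurable X]setTI.
by apply: measurable_enorm => //; exact: measurable_itv.
Qed.

(** Since [fine] sends +oo to 0, the volume must be shown finite as well as nonzero: the ball
    contains a small cube and lies in the cube of half-side 1. *)
Lemma unit_ball_volume_gt0 (R : realType) d : 0 < unit_ball_volume R d.
Proof.
rewrite /unit_ball_volume; apply: fine_gt0; apply/andP; split.
  (* With this [e] the sum of squares is at most d e = d / (d + 1) < 1, because e^2 <= e. *)
  set e : R := d.+1%:R^-1.
  have e0 : 0 < e by rewrite invr_gt0.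
  apply: (@lt_le_trans _ _ (lebesgue_measure_Rn R d
      [set x | forall i, `|tnth x i| <= e])).
    by rewrite lebesgue_measure_Rn_box ?ltW// lte_fin exprn_gt0// mulr_gt0.
  apply: le_measure; rewrite ?inE; [exact: measurable_Rn_box|
    exact: measurable_enorm_ball|move=> x /= xe].
  rewrite -ltr_sqr ?nnegrE ?enorm_ge0// sqr_enorm expr1n.
  apply: (@le_lt_trans _ _ (\sum_(i < d) e)).
    apply: ler_sum => i _; rewrite -real_normK ?num_real// expr2.
    rewrite -[leRHS]mul1r ler_pM// (le_trans (xe i))//.
    by rewrite invf_le1 ?ler1n.
  by rewrite sumr_const card_ord -mulr_natl ltr_pdivrMr// mul1r ltr_nat.
apply: (@le_lt_trans _ _ (lebesgue_measure_Rn R d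
    [set x | forall i, `|tnth x i| <= 1])).
  apply: le_measure; rewrite ?inE; [exact: measurable_enorm_ball|
    exact: measurable_Rn_box|move=> x /= x1 i].
  exact: le_trans (ler_abs_enorm _ _ x i) (ltW x1).
by rewrite lebesgue_measure_Rn_box// ltry.
Qed.

Lemma lebesgue_measure_Rn_ball (R : realType) d (r : R) : 0 < r ->
  lebesgue_measure_Rn R d [set x | enorm x < r] =
  (r ^+ d * unit_ball_volume R d)%:E.
Proof.
move=> r0.
rewrite (lebesgue_measure_Rn_preimage_scale _ _ r)//; last exact: measurable_enorm_ball.
rewrite (_ : _ @^-1` _ = [set x | enorm x < 1]); last first.
  by apply/seteqP; split => x /=; rewrite enorm_scale_Rn ?ltW// gtr_pMr.
rewrite EFinM /unit_ball_volume fineK//.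
(* A positive [fine] part rules out the infinite values. *)
have := unit_ball_volume_gt0 R d; rewrite /unit_ball_volume.
by case: (lebesgue_measure_Rn R d _) => //=; rewrite ltxx.
Qed.

(** * Lower bound for the Rollnik double integral *)

Lemma integral_indicD d (T : measurableType d) (R : realType)
    (mu : {measure set T -> \bar R}) (A B : set T) (u w a b : R) :
  measurable A -> measurable B -> mu A = a%:E -> mu B = b%:E ->
  0 <= u -> 0 <= w ->
  (\int[mu]_x (u * \1_A x + w * \1_B x)%:E = (u * a + w * b)%:E)%E.
Proof.
move=> mA mB muA muB u0 w0.
under eq_integral do rewrite EFinD !EFinM.
have mI (C : set T) : measurable C ->
    measurable_fun [set: T] (fun x => (\1_C x : R)%:E).
  by move=> mC; apply/measurable_EFinP; exact: measurable_indic.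
rewrite ge0_integralD//; last 4 first.
- by move=> x _; rewrite mule_ge0// lee_fin.
- by apply: measurable_funeM; exact: mI.
- by move=> x _; rewrite mule_ge0// lee_fin.
- by apply: measurable_funeM; exact: mI.
rewrite !ge0_integralZl_EFin//; [|exact: mI|exact: mI].
by rewrite !integral_indic// !setIT muA muB.
Qed.

Lemma rollnik_kernel_ge (R : realType) d (x y : Rn R d) (p c r : R)
    (vx vy : \bar R) :
  0 <= p -> 0 < c -> 0 <= r -> enorm (sub_Rn x y) <= c ->
  (r%:E <= vx)%E -> (r%:E <= vy)%E ->
  ((r ^+ 2 * c `^ (- p))%:E <=
     `|vx| * `|vy| / (enorm (sub_Rn x y) `^ p)%:E)%E.
Proof.
move=> p0 c0 r0 xyc rx ry.
have rE : (0 <= r%:E)%E by rewrite lee_fin.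
rewrite !gee0_abs; [|exact: le_trans ry|exact: le_trans rx].
rewrite EFinM expr2 EFinM; apply: lee_pmul => //.
- by rewrite mule_ge0.
- by rewrite lee_fin powR_ge0.
- exact: lee_pmul.
have cp0 : 0 < c `^ p by exact: powR_gt0.
(* The inverses are compared in [\bar R], where inversion is antitone on nonnegative values
   including 0; this covers the diagonal. *)
rewrite powRN -(_ : ((c `^ p)%:E^-1 = (c `^ p)^-1%:E)%E); last first.
  by rewrite inver gt_eqF.
by rewrite lee_pV2 ?inE ?lee_fin ?powR_ge0// ge0_ler_powR// nnegrE ?enorm_ge0// ltW.
Qed.

(** A real [r] stands in for v(t), which might be +oo. The bound is the exact integral of a two-step
    minorant. *)
Lemma rollnik_sqnorm_ge (R : realType) d (alpha t r : R)
    (V : Rn R d -> \bar R) (p := 2 * (d%:R - alpha)) : alpha <= d%:R -> 0 < t -> 0 <= r ->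
  (forall x, enorm x < t -> (r%:E <= V x)%E) ->
  ((r ^+ 2 * ((2 * t) `^ (- p) * (t ^+ d * unit_ball_volume R d) ^+ 2
     + (t `^ (- p) - (2 * t) `^ (- p))
         * ((t / 2) ^+ d * unit_ball_volume R d) ^+ 2))%:E
    <= rollnik_sqnorm alpha V)%E.
Proof.
move=> ad t0 r0 rV.
have p0 : 0 <= p by rewrite mulr_ge0// subr_ge0.
pose A : set (Rn R d) := [set x | enorm x < t].
pose B : set (Rn R d) := [set x | enorm x < t / 2].
pose a := (2 * t) `^ (- p); pose b := t `^ (- p) - a.
have a0 : 0 <= a by exact: powR_ge0.
have b0 : 0 <= b.
  rewrite subr_ge0 /a !powRN lef_pV2 ?posrE ?powR_gt0 ?mulr_gt0//.
  by rewrite ge0_ler_powR// ?nnegrE; lra.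
have mA : measurable A by exact: measurable_enorm_ball.
have mB : measurable B by exact: measurable_enorm_ball.
have muA := lebesgue_measure_Rn_ball R d t t0.
have muB := lebesgue_measure_Rn_ball R d (t / 2) (divr_gt0 t0 (ltr0Sn _ _)).
rewrite -/A -/B in muA muB.
set mA' := t ^+ d * _ in muA *; set mB' := (t / 2) ^+ d * _ in muB *.
have mA'0 : 0 <= mA' by rewrite -lee_fin -muA.
have mB'0 : 0 <= mB' by rewrite -lee_fin -muB.
have BA x : B x -> A x by rewrite /A/B/=; lra.
(* As a + b = t^(-p), [g] is r^2 t^(-p) on B x B, r^2 (2t)^(-p) on the rest of A x A, and 0
   elsewhere. *)
pose g x y := r ^+ 2 * a * \1_A x * \1_A y + r ^+ 2 * b * \1_B x * \1_B y.
rewrite (_ : (_ * _)%:E =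
    (\int[lebesgue_measure_Rn R d]_x \int[lebesgue_measure_Rn R d]_y (g x y)%:E)%E);
  last first.
  under eq_integral => x _.
    rewrite (integral_indicD _ _ _ _ _ _ _ _ _ _ mA mB muA muB)//; last 2 first.
    - by rewrite !mulr_ge0// sqr_ge0.
    - by rewrite !mulr_ge0// sqr_ge0.
    (* Bringing the indicators of [x] to the right gives the outer integrand the shape of the inner
       one. *)
    rewrite -mulrA [\1_A x * _]mulrC mulrA -[r ^+ 2 * b * _ * _]mulrA.
    rewrite [\1_B x * _]mulrC [r ^+ 2 * b * _]mulrA.
    over.
  rewrite (integral_indicD _ _ _ _ _ _ _ _ _ _ mA mB muA muB); first last.
  - by apply: mulr_ge0 => //; rewrite !mulr_ge0// sqr_ge0.
  - by apply: mulr_ge0 => //; rewrite !mulr_ge0// sqr_ge0.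
  by congr EFin; rewrite -/a -/b; ring.
have g0 x y : 0 <= g x y by rewrite addr_ge0// !mulr_ge0//.
apply: ge0_integral_le => x.
  by apply: integral_ge0 => y _; rewrite lee_fin.
apply: ge0_integral_le => y; first by rewrite lee_fin.
have rhs0 : (0 <= `|V x| * `|V y| / (enorm (sub_Rn x y) `^ p)%:E)%E.
  by rewrite !mule_ge0// inve_ge0 lee_fin powR_ge0.
rewrite /g !indicE.
have [Ax|nAx] := boolP (x \in A); last first.
  have /negbTE -> : x \notin B.
    by apply: contra nAx; rewrite !inE; exact: BA.
  by rewrite !(mulr0, mul0r) addr0.
have [Ay|nAy] := boolP (y \in A); last first.
  have /negbTE -> : y \notin B.
    by apply: contra nAy; rewrite !inE; exact: BA.
  by rewrite !(mulr0, mul0r) addr0.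
have [rx ry] : ((r%:E <= V x) /\ (r%:E <= V y))%E.
  by split; apply: rV; [move: Ax|move: Ay]; rewrite inE.
have [/andP[Bx By]|nB] := boolP ((x \in B) && (y \in B)).
  rewrite Bx By !mulr1 -mulrDr /b addrC subrK.
  apply: rollnik_kernel_ge => //.
  move: Bx By; rewrite !inE => Bx By.
  rewrite -(_ : 2 * (t / 2) = t); last by field.
  by apply: enorm_sub_Rn_le; apply: ltW.
rewrite -[r ^+ 2 * b * _ * _]mulrA -natrM mulnb (negbTE nB) mulr0 addr0 !mulr1.
apply: rollnik_kernel_ge => //; first by rewrite mulr_gt0.
by move: Ax Ay; rewrite !inE => Ax Ay; apply: enorm_sub_Rn_le; exact: ltW.
Qed.

(** * Positivity of the norm and the strict bound *)

(** The point must avoid the origin: its norm will be the radius of a ball in the lower bound. *)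
Lemma not_ae0_exists_neq0 (R : realType) d (V : Rn R d -> \bar R) :
  (0 < d)%N -> ~ {ae lebesgue_measure_Rn R d, forall x, V x = 0%E} ->
  exists2 x, 0 < enorm x & V x <> 0%E.
Proof.
move=> d0; apply: contra_notP => nV.
(* The box of half-side 0 is the origin, hence a null set. *)
exists [set x | forall i, `|tnth x i| <= 0]; split.
- exact: measurable_Rn_box.
- by rewrite lebesgue_measure_Rn_box// mulr0 expr0n gtn_eqF.
move=> x /= Vx0 i; rewrite leNgt; apply/negP => xi; apply: nV; exists x => //.
exact: lt_le_trans xi (ler_abs_enorm _ _ x i).
Qed.

(** Rewrites the kernel bound through the powers in the target constant and in the ball volume, so
    that the final identity is purely algebraic. *)
Lemma powR_rollnik_exponent (R : realType) d (alpha t : R) : 0 < t ->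
  (2 * t) `^ (- (2 * (d%:R - alpha))) =
  (2 `^ (d%:R - alpha) * (t ^+ d * t `^ (- alpha))) ^- 2.
Proof.
move=> t0; rewrite [LHS]powRN [2 * (_ - _)]mulrC powRrM powR_mulrn ?powR_ge0//.
rewrite powRM ?ltW// (@powRD _ t) ?(gt_eqF t0) ?implybT// powR_mulrn//.
exact: ltW.
Qed.

Theorem theorem3p19 (R : realType) (d : nat) (alpha : R)
    (alpha_gt0 : 0 < alpha) (alpha_lt2 : alpha < 2)
    (alpha_lt_d : alpha < d%:R) (d_lt_2alpha : d%:R < 2 * alpha)
    (V : Rn R d -> \bar R) (v : R -> \bar R)
    (V_rollnik : rollnik_class alpha V)
    (V_neq0 : ~ {ae lebesgue_measure_Rn R d, forall x, V x = 0%E})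
    (V_ge0 : forall x, (0 <= V x)%E)
    (V_radial : radially_symmetric V)
    (v_profile : is_profile V v)
    (v_noninc : forall s t : R, 0 <= s -> s <= t -> (v t <= v s)%E) :
  exists2 t0 : R, 0 < t0 & forall t : R, 0 < t < t0 ->
    (v t < (2 `^ (d%:R - alpha) * rollnik_norm alpha V
              / unit_ball_volume R d * t `^ (- alpha))%:E)%E.
Proof.
have d0 : (0 < d)%N by rewrite -(ltr_nat R); exact: lt_trans alpha_lt_d.
set w := unit_ball_volume R d; have w0 : 0 < w by exact: unit_ball_volume_gt0.
set N := rollnik_norm alpha V.
pose p := 2 * (d%:R - alpha).
have p0 : 0 < p by rewrite mulr_gt0// subr_gt0.
have sqnorm_ge0 : (0 <= rollnik_sqnorm alpha V)%E.
  apply: integral_ge0 => x _; apply: integral_ge0 => y _.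
  by rewrite !mule_ge0// inve_ge0 lee_fin powR_ge0.
have N2 : (N ^+ 2)%:E = rollnik_sqnorm alpha V.
  rewrite sqr_sqrtr ?fine_ge0// fineK// ge0_fin_numE//.
  by case: V_rollnik.
have N0 : 0 <= N by exact: sqrtr_ge0.
pose b t := (t `^ (- p) - (2 * t) `^ (- p)) * ((t / 2) ^+ d * w) ^+ 2.
have key t r : 0 < t -> 0 <= r -> (r%:E <= v t)%E ->
    r ^+ 2 * ((2 * t) `^ (- p) * (t ^+ d * w) ^+ 2 + b t) <= N ^+ 2.
  move=> t0 r0 rv; rewrite -lee_fin N2.
  apply: rollnik_sqnorm_ge => //; first exact: ltW.
  move=> x xt; apply: (le_trans rv).
  rewrite -(v_profile _ (enorm_ge0 _ _ x) x erefl).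
  by apply: v_noninc; [exact: enorm_ge0|exact: ltW].
have b_gt0 t : 0 < t -> 0 < b t.
  move=> t0; rewrite mulr_gt0//.
    rewrite subr_gt0 !powRN ltf_pV2 ?posrE ?powR_gt0 ?mulr_gt0//.
    by rewrite gt0_ltr_powR// ?nnegrE; lra.
  by rewrite exprn_gt0// mulr_gt0// exprn_gt0// divr_gt0.
(* If [N] were 0, [key] at the radius |x| of a point with V(x) > 0 would bound a positive number by
   0. Positivity of [N] makes the constant [C] below positive. *)
have N_gt0 : 0 < N.
  have [x x0 /eqP Vx] := not_ae0_exists_neq0 _ _ _ d0 V_neq0.
  have [r r0 rVx] : exists2 r : R, 0 < r & (r%:E <= V x)%E.
    have : (0 < V x)%E by rewrite lt_neqAle eq_sym Vx V_ge0.
    case: (V x) => [r|_|//]; first by rewrite lte_fin => ?; exists r.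
    by exists 1; rewrite // leey.
  rewrite -(v_profile _ (ltW x0) x erefl) in rVx.
  rewrite lt_neqAle N0 andbT eq_sym; apply/eqP => NE.
  have := key _ r x0 (ltW r0) rVx; rewrite NE expr0n/=; apply/negP.
  rewrite -ltNge mulr_gt0 ?exprn_gt0// addr_gt0 ?b_gt0//.
  by rewrite mulr_gt0 ?powR_gt0 ?mulr_gt0// exprn_gt0// mulr_gt0// exprn_gt0.
(* The value 1 is arbitrary. If C <= v(t), then [key] with [r := C] gives N^2 + C^2 b(t) <= N^2,
   which is absurd. *)
exists 1 => // t /andP[t0 _]; rewrite ltNge; apply/negP => Cv.
set C := (X in (X%:E <= _)%E) in Cv.
have C0 : 0 < C by rewrite !mulr_gt0 ?invr_gt0 ?powR_gt0.
have := key t C t0 (ltW C0) Cv; apply/negP; rewrite -ltNge mulrDr.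
have Cb : 0 < C ^+ 2 * b t by apply: mulr_gt0; [exact: exprn_gt0|exact: b_gt0].
rewrite [X in X + _](_ : _ = N ^+ 2) ?ltrDl//.
rewrite powR_rollnik_exponent// /C.
have : 2 `^ (d%:R - alpha) != 0 by rewrite gt_eqF// powR_gt0.
have : t `^ (- alpha) != 0 by rewrite gt_eqF// powR_gt0.
have : t ^+ d != 0 by rewrite gt_eqF// exprn_gt0.
have : w != 0 by rewrite gt_eqF.
(* Generalizing the powers makes them atoms for [field]. *)
move: (2 `^ _) (t `^ _) (t ^+ _) => x y z w_neq0 z_neq0 y_neq0 x_neq0.
by field; rewrite x_neq0 y_neq0 z_neq0 w_neq0.
Qed.
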